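(* For every $a,b\in\mathbb{N}$, the set $\{an+b:n\in\mathbb{N}\}$ is a set of multiplicative recurrence if and only if $a\mid b(b-1)$.
   Context: $\mathbb{N}=\{1,2,\dots\}$. A measure preserving $(\mathbb{Q}^{>0},\times)$-system $(X,\mathcal{B},\mu,T)$ consists of a probability space $(X,\mathcal{B},\mu)$ and measure preserving transformations $T_r:X\to X$, $r\in\mathbb{Q}^{>0}$, forming an action of the group $(\mathbb{Q}^{>0},\times)$ of positive rationals, so $T_{rs}=T_r\circ T_s$. A set $R\subset\mathbb{Q}^{>0}$ is a set of (measurable) multiplicative recurrence if for every measure preserving $(\mathbb{Q}^{>0},\times)$-system $(X,\mathcal{B},\mu,T)$ and every $A\in\mathcal{B}$ with $\mu(A)>0$ there exists $r\in R$ with $\mu(A\cap T_r^{-1}A)>0$. *)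

(* Defs.v *)
From HB Require Import structures.
From mathcomp Require Import all_boot all_order all_algebra.
From mathcomp Require Import all_classical all_reals all_analysis.

Set Implicit Arguments.
Unset Strict Implicit.
Unset Printing Implicit Defensive.

Import Order.TTheory GRing.Theory Num.Theory.

Local Open Scope classical_set_scope.
Local Open Scope ring_scope.

Definition measure_preserving (R : realType) (d : measure_display)
    (X : measurableType d) (mu : probability X R) (f : X -> X) : Prop :=
  measurable_fun setT f /\
  forall A : set X, measurable A -> mu (f @^-1` A) = mu A.

(* The positive rationals are the r : rat with 0 < r; the maps T r for r <= 0
   are unconstrained and never used. *)
Record mult_system (R : realType) (d : measure_display)
    (X : measurableType d) (mu : probability X R) (T : rat -> X -> X) : Prop :=
  MultSystem {
    mult_system_preserving :
      forall r : rat, 0 < r -> measure_preserving mu (T r) ;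
    mult_system_one : forall x : X, T 1 x = x ;
    mult_system_mul :
      forall r s : rat, 0 < r -> 0 < s ->
        forall x : X, T (r * s) x = T r (T s x) }.

(* measurableType carries a distinguished point, which is no restriction since
   a probability space is nonempty. *)
Definition mult_recurrence (R : realType) (S : set rat) : Prop :=
  S `<=` [set r : rat | 0 < r] /\
  forall (d : measure_display) (X : measurableType d) (mu : probability X R)
    (T : rat -> X -> X),
    mult_system mu T ->
    forall A : set X, measurable A -> (0 < mu A)%E ->
      exists2 r : rat, S r & (0 < mu (A `&` T r @^-1` A))%E.

(* Main.v *)
Require Import Defs.
From HB Require Import structures.
From mathcomp Require Import all_boot all_order all_algebra.
From mathcomp Require Import all_classical all_reals all_analysis.
From mathcomp Require Import finmap ring.

(** If a divides b(b - 1), then b is idempotent modulo a, so every power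
    (a + b)^(k+1) is congruent to b modulo a and exceeds b: the progression
    contains all positive powers of the single number r = a + b.  Along the
    powers of r the action is the iteration of the one measure preserving map
    T_r, and Poincare's recurrence theorem ([poincare_recurrence]) gives a
    return.

    If a does not divide b(b - 1), some prime power p^k exactly dividing a
    does not divide b(b - 1) either, and k is positive.  It suffices to find a
    homomorphism from the positive rationals to the units of a finite ring
    that never takes the value 1 on the progression: the rationals then act by
    multiplication on that ring with its uniform measure, and the singleton
    {1} never meets its preimage under T_r for r in the progression
    ([not_mult_recurrence_character]).  Since the numbers an + b are all
    congruent to b modulo p^k, there are two cases.
    - If p does not divide b, the class modulo p^k of the part of r prime to p
      is such a homomorphism, with the constant value b, which differs from 1
      modulo p^k ([not_recurrence_unit_residue]).
    - If p divides b, then p^k does not divide b, so the p-adic valuation of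
      every an + b is that of b, say v, with 0 < v < k.  The homomorphism
      sending r to 2 to the power of its p-adic valuation, in the integers
      modulo 2^v + 1, has the constant value 2^v = -1, which differs from 1
      ([not_recurrence_divisible_residue]). *)

Import Order.TTheory GRing.Theory Num.Theory.

Local Open Scope classical_set_scope.
Local Open Scope ring_scope.

Set Implicit Arguments.
Unset Strict Implicit.
Unset Printing Implicit Defensive.

(** * Recurrence along the powers of one number *)

Section Poincare.
Context (R : realType) (d : measure_display) (X : measurableType d).
Context (mu : probability X R) (f : X -> X) (A : set X).
Hypothesis mpf : measure_preserving mu f.
Hypothesis mA : measurable A.

Let measurable_preimage_iter k (B : set X) :
  measurable B -> measurable (iter k f @^-1` B).
Proof.
elim: k => [|k IH] //= mB.
have := mpf.1 measurableT _ (IH mB); rewrite setTI -comp_preimage.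
by congr measurable; apply/seteqP; split => x /=; rewrite -iterSr.
Qed.

Let measure_preimage_iter k (B : set X) :
  measurable B -> mu (iter k f @^-1` B) = mu B.
Proof.
elim: k => [|k IH] // mB.
rewrite -(IH mB) -(mpf.2 _ (measurable_preimage_iter k mB)).
by congr (mu _); apply/seteqP; split => x /=; rewrite -iterSr.
Qed.

Let returning := \bigcup_k (iter k.+1 f @^-1` A).

Let mreturning : measurable returning.
Proof. by apply: bigcupT_measurable => k; exact: measurable_preimage_iter. Qed.

Let wandering := A `\` returning.

Let mwandering : measurable wandering.
Proof. exact: measurableD. Qed.

(** A point of the i-th preimage that also lay in a later one would be
    sent by the i-th iterate to a point of [wandering] that returns to [A]. *)
Let trivIset_wandering : trivIset setT (fun i => iter i f @^-1` wandering).
Proof.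
suff dis i k x : wandering (iter i f x) -> ~ wandering (iter (k.+1 + i) f x).
  move=> i j _ _ [x [Wi Wj]]; case: (ltngtP i j) => // ij; exfalso.
  - apply: (dis i (j - i.+1)%N x Wi).
    by rewrite addSnnS subnK.
  - apply: (dis j (i - j.+1)%N x Wj).
    by rewrite addSnnS subnK.
move=> [_ nret] [Ax _]; apply: nret; exists k => //=.
by rewrite -iterS -iterD.
Qed.

(** Infinitely many disjoint sets of the same measure fit in a probability
    space only if that measure is zero. *)
Let measure_wandering : mu wandering = 0%E.
Proof.
apply/eqP; rewrite eq_le measure_ge0 andbT leNgt; apply/negP => W0.
have Wfin : mu wandering \is a fin_num by exact: fin_num_measure.
set w := fine (mu wandering).
have w0 : 0 < w by rewrite /w -lte_fin fineK.
have bound n : n%:R * w <= 1.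
  have mF i : measurable (iter i f @^-1` wandering).
    exact: measurable_preimage_iter.
  have := measure_bigsetU mu mF trivIset_wandering n.
  rewrite (eq_bigr _ (fun (i : 'I_n) _ => measure_preimage_iter i mwandering)).
  rewrite -(fineK Wfin) sumEFin sumr_const card_ord => E.
  rewrite mulr_natl -lee_fin -E; apply: probability_le1.
  exact: bigsetU_measurable.
have := bound (Num.truncn w^-1).+1; apply/negP; rewrite -ltNge.
by rewrite -ltr_pdivrMr // div1r truncnS_gt.
Qed.

(** Almost every point of [A] returns to [A], since the points that do not
    return form [wandering]; so [A] minus a null set is covered by countably
    many sets of returning points, and these cannot all be null. *)
Theorem poincare_recurrence : (0 < mu A)%E ->
  exists k, (0 < mu (A `&` iter k.+1 f @^-1` A))%E.
Proof.
move=> A0; apply: contrapT => /forallNP null.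
have ret0 : mu (A `&` returning) = 0%E.
  apply/negligibleP; first exact: measurableI.
  rewrite setI_bigcupr; apply: negligible_bigcup => k.
  have mAk : measurable (A `&` iter k.+1 f @^-1` A).
    by apply: measurableI => //; exact: measurable_preimage_iter.
  apply/negligibleP => //; apply/eqP; rewrite eq_le measure_ge0 andbT leNgt.
  exact/negP/null.
have muA : mu A = (mu wandering + mu (A `&` returning))%E by exact: measureDI.
by move: A0; rewrite muA ret0 measure_wandering adde0 ltxx.
Qed.

End Poincare.

Lemma mult_system_exp (R : realType) (d : measure_display)
    (X : measurableType d) (mu : probability X R) (T : rat -> X -> X) (r : rat) :
  mult_system mu T -> 0 < r -> forall k, T (r ^+ k) =1 iter k (T r).
Proof.
move=> ms r0; elim=> [|k IH] x; first by rewrite expr0 (mult_system_one ms).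
by rewrite exprS (mult_system_mul ms) ?exprn_gt0 //= IH.
Qed.

Lemma mult_recurrence_powers (R : realType) (S : set rat) (r : rat) :
  S `<=` [set s | 0 < s] -> 0 < r -> (forall k, S (r ^+ k.+1)) ->
  mult_recurrence R S.
Proof.
move=> Spos r0 Sr; split=> // d X mu T ms A mA A0.
have [k Ak] := poincare_recurrence (mult_system_preserving ms r0) mA A0.
exists (r ^+ k.+1); first exact: Sr.
by rewrite (funext (mult_system_exp ms r0 k.+1)).
Qed.

(** * Finite rotations *)

(** An alias, so that the discrete sigma-algebra does not become the default
    measurable structure of every finite ring. *)
Definition discrete (V : finComUnitRingType) : Type := V.

HB.instance Definition _ (V : finComUnitRingType) :=
  Finite.copy (discrete V) V.
HB.instance Definition _ (V : finComUnitRingType) :=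
  isPointed.Build (discrete V) (0 : V).
HB.instance Definition _ (V : finComUnitRingType) :=
  @isMeasurable.Build default_measure_display (discrete V)
    discrete_measurable discrete_measurable0
    discrete_measurableC discrete_measurableU.

(** The Dirac mass is the default value that [mnormalize] takes for measures
    that cannot be normalized; the counting measure of a nonempty finite set
    can be. *)
Definition uniform (R : realType) (V : finComUnitRingType) :
    probability (discrete V) R :=
  mnormalize (counting : {measure set (discrete V) -> \bar R}) (dirac point).

Lemma uniformE (R : realType) (V : finComUnitRingType) :
  exists2 c : R, 0 < c & forall A : set (discrete V),
    uniform R V A = (#|` fset_set A|%:R * c)%:E.
Proof.
have fin (A : set (discrete V)) : finite_set A by exact: finite_finset.
pose N := #|` fset_set [set: discrete V]|.
have N0 : 0 < N%:R :> R.
  rewrite ltr0n cardfs_gt0.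
  apply/eqP => /(fset_set_set0 (fin _)) E.
  by have : [set: discrete V] point by []; rewrite E.
exists (N%:R^-1) => [|A]; first by rewrite invr_gt0.
rewrite /uniform /= /mnormalize /= /counting !asboolT //= -/N.
by rewrite eqe (gt_eqF N0) /= asboolT // EFinM.
Qed.

Lemma uniform_preimage (R : realType) (V : finComUnitRingType)
    (g : V -> V) (A : set (discrete V)) :
  injective g -> uniform R V (g @^-1` A) = uniform R V A.
Proof.
move=> ginj; have [c _ E] := uniformE R V; rewrite !E.
have [h hK gK] := injF_bij ginj.
have {2}-> : A = g @` (g @^-1` A).
  apply/seteqP; split=> [x Ax|_ [x Ax <-] //].
  by exists (h x) => //=; rewrite gK.
by rewrite fset_set_image ?card_imfset //; exact: finite_finset.
Qed.

Lemma uniform_gt0 (R : realType) (V : finComUnitRingType)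
    (A : set (discrete V)) : A !=set0 -> (0 < uniform R V A)%E.
Proof.
have [c c0 ->] := uniformE R V; move=> [x Ax].
rewrite lte_fin mulr_gt0 // ltr0n cardfs_gt0; apply/eqP.
by move=> /(fset_set_set0 finite_finset) A0; rewrite A0 in Ax.
Qed.

(** A completely multiplicative function on the positive integers, with unit
    values, extends to the positive rationals by taking quotients; the reduced
    fraction serves as the representative. *)
Definition rat_extension (V : comUnitRingType) (f : nat -> V) (r : rat) : V :=
  f `|numq r|%N / f `|denq r|%N.

Section RatExtension.
Context (V : comUnitRingType) (f : nat -> V).
Hypothesis f1 : f 1%N = 1.
Hypothesis fM : forall m n, (0 < m)%N -> (0 < n)%N -> f (m * n)%N = f m * f n.
Hypothesis funit : forall n, (0 < n)%N -> f n \is a GRing.unit.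

Let numq_absz_gt0 (r : rat) : 0 < r -> (0 < `|numq r|)%N.
Proof. by move=> r0; rewrite absz_gt0 numq_eq0 gt_eqF. Qed.

Let denq_absz_gt0 (r : rat) : (0 < `|denq r|)%N.
Proof. by rewrite absz_gt0 denq_eq0. Qed.

Lemma rat_extension_nat n : rat_extension f n%:R = f n.
Proof.
have E : (n%:R : rat) = n%:Z%:~R by rewrite pmulrn.
by rewrite /rat_extension E numq_int denq_int /= f1 divr1.
Qed.

Lemma rat_extension_unit r : 0 < r -> rat_extension f r \is a GRing.unit.
Proof.
by move=> r0; rewrite unitrM unitrV !funit ?numq_absz_gt0 ?denq_absz_gt0.
Qed.

Lemma rat_extensionM r s : 0 < r -> 0 < s ->
  rat_extension f (r * s) = rat_extension f r * rat_extension f s.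
Proof.
move=> r0 s0; have rs0 : 0 < r * s by rewrite mulr_gt0.
(* The reduced fraction of r * s is not the product of the reduced fractions;
   the two are compared after clearing denominators. *)
have E : numq (r * s) * (denq r * denq s) = numq r * numq s * denq (r * s).
  apply: (@intr_inj rat); rewrite !rmorphM /=.
  by rewrite !numqE; ring.
have {}E := congr1 absz E; rewrite !abszM in E.
have {}E := congr1 f E.
rewrite !fM ?muln_gt0 ?numq_absz_gt0 ?denq_absz_gt0 // in E.
have u x : f `|denq x|%N \is a GRing.unit by exact: funit.
have ude : f `|denq r|%N * f `|denq s|%N \is a GRing.unit by rewrite unitrM !u.
rewrite /rat_extension mulrACA -invrM // (mulrC (f `|denq s|%N)).
by apply: (mulIr (u (r * s))); apply: (mulIr ude); rewrite divrK // [RHS]mulrAC divrK.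
Qed.
End RatExtension.

(** Under the action by multiplication through the extension of [f], the map
    attached to n sends 1 to f n, hence moves the set {1} off itself. *)
Lemma not_mult_recurrence_character (R : realType) (V : finComUnitRingType)
    (f : nat -> V) (S : set nat) :
  f 1%N = 1 ->
  (forall m n, (0 < m)%N -> (0 < n)%N -> f (m * n)%N = f m * f n) ->
  (forall n, (0 < n)%N -> f n \is a GRing.unit) ->
  (forall n, S n -> f n != 1) ->
  ~ mult_recurrence R [set n%:R | n in S].
Proof.
move=> f1 fM fU Sf [_ rec].
pose T (r : rat) (x : discrete V) : discrete V := rat_extension f r * (x : V).
have Tinj r : 0 < r -> injective (T r).
  by move=> r0; apply: mulrI; exact: rat_extension_unit.
have ms : mult_system (uniform R V) T.
  split=> [r r0|x|r s r0 s0 x].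
  - by split=> [//|A _]; apply: uniform_preimage; exact: Tinj.
  - by rewrite /T (rat_extension_nat f1 1) f1 mul1r.
  - by rewrite /T rat_extensionM // mulrA.
pose A : set (discrete V) := [set (1 : V)].
have A0 : (0 < uniform R V A)%E.
  by apply: uniform_gt0; exists (1 : V).
have [_ [n Sn <-]] := rec _ _ _ T ms _ I A0.
suff -> : A `&` T n%:R @^-1` A = set0.
  by rewrite measure0 ltxx.
apply/seteqP; split=> // x [/= ->]; rewrite /T rat_extension_nat // mulr1.
by move=> fn1; have := Sf n Sn; rewrite fn1 eqxx.
Qed.

(** * Residue classes that are not sets of recurrence *)

Lemma eqr_nat_Zp m i j : (1 < m)%N ->
  (i%:R == j%:R :> 'Z_m) = (i == j %[mod m])%N.
Proof. by move=> m1; rewrite !Zp_nat -val_eqE /= Zp_cast. Qed.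

Section Residues.
Context (R : realType) (p k b : nat) (S : set nat).
Hypothesis pp : prime p.
Hypothesis k0 : (0 < k)%N.
Hypothesis Sb : forall n, S n -> (0 < n)%N /\ (n = b %[mod p ^ k])%N.

Let pk1 : (1 < p ^ k)%N.
Proof. by rewrite -(expn0 p) ltn_exp2l // prime_gt1. Qed.

(** The elements of [S] are prime to p, so taking the part prime to p leaves
    them unchanged, and the character takes on them the value b modulo p ^ k.
    Removing the powers of p makes the residue a unit at every positive
    integer. *)
Lemma not_recurrence_unit_residue :
  ~~ (p %| b)%N -> (b != 1 %[mod p ^ k])%N ->
  ~ mult_recurrence R [set n%:R | n in S].
Proof.
move=> pb b1.
apply: (@not_mult_recurrence_character R 'Z_(p ^ k) (fun n => (n`_p^')%N%:R)).
- by rewrite partn1.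
- by move=> m n m0 n0; rewrite partnM // natrM.
- move=> n n0; rewrite unitZpE // coprimeXl // prime_coprime //.
  by rewrite -p'natE //; exact: part_pnat.
- move=> n /Sb[n0 nb].
  have np : ~~ (p %| n)%N.
    by rewrite /dvdn -(modn_dvdm n (dvdn_exp k0 (dvdnn p))) nb modn_dvdm // dvdn_exp.
  rewrite part_pnat_id ?p'natE // (_ : 1 = 1%:R) // eqr_nat_Zp // nb //.
Qed.

(** The modulus 2 ^ v + 1 only serves to provide a unit, namely 2, whose v-th
    power is not 1; it is here that v has to be positive. *)
Lemma not_recurrence_divisible_residue :
  (0 < b)%N -> (p %| b)%N -> ~~ (p ^ k %| b)%N ->
  ~ mult_recurrence R [set n%:R | n in S].
Proof.
move=> b0 pb pkb; set v := logn p b.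
have v0 : (0 < v)%N by rewrite -pfactor_dvdn // expn1.
have vk : (v < k)%N by rewrite ltnNge -pfactor_dvdn.
have m2 : (2 < (2 ^ v).+1)%N by rewrite ltnS -{1}(expn1 2) leq_exp2l.
apply: (@not_mult_recurrence_character R 'Z_(2 ^ v).+1
  (fun n => (2 ^ logn p n)%N%:R)).
- by rewrite logn1.
- by move=> m n m0 n0; rewrite lognM // expnD natrM.
- move=> n n0; rewrite unitZpE; last exact: ltnW.
  by rewrite coprimeXr // coprimen2 /= oddX /= orbF -lt0n v0.
- move=> n /Sb[n0 nb].
  have dvd j : (j <= k)%N -> (p ^ j %| n)%N = (p ^ j %| b)%N.
    move=> jk; rewrite /dvdn.
    by rewrite -(modn_dvdm n (dvdn_exp2l p jk)) nb modn_dvdm // dvdn_exp2l.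
  have -> : logn p n = v.
    apply/eqP; rewrite eqn_leq leqNgt -!pfactor_dvdn // !dvd ?(ltnW vk) //.
    by rewrite !pfactor_dvdn // ltnn leqnn.
  rewrite (_ : 1 = 1%:R) // eqr_nat_Zp ?(ltnW m2) // !modn_small ?(ltnW m2) //.
  by rewrite gtn_eqF.
Qed.

End Residues.

Theorem theorem1p10 (R : realType) (a b : nat) (ha : (0 < a)%N) (hb : (0 < b)%N) :
  mult_recurrence R
    [set r : rat | exists n : nat, (0 < n)%N /\ r = ((a * n + b)%N)%:R]
  <-> (a %| b * (b - 1))%N.
Proof.
split=> [rec|ab].
- apply/(dvdn_partP _ ha) => p; rewrite mem_primes => /and3P[pp _ pa].
  rewrite p_part; set k := logn p a.
  have k0 : (0 < k)%N by rewrite -pfactor_dvdn // expn1.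
  pose S := [set (a * n + b)%N | n in [set n | (0 < n)%N]].
  have Sb n : S n -> (0 < n)%N /\ (n = b %[mod p ^ k])%N.
    move=> [i i0 <-]; rewrite addn_gt0 hb orbT; split=> //.
    apply/eqP; rewrite -[X in _ == X %[mod _]]add0n eqn_modDr mod0n.
    exact/dvdn_mulr/pfactor_dvdnn.
  have {}rec : mult_recurrence R [set n%:R | n in S].
    congr (mult_recurrence R _): rec; apply/seteqP; split=> r.
      by move=> [n [n0 ->]]; exists (a * n + b)%N => //; exists n.
    by move=> [_ [n n0 <-] <-]; exists n.
  apply: contrapT => /negP ndvd.
  case: (boolP (p %| b)%N) => pb.
    have ndvdb : ~~ (p ^ k %| b)%N by apply: contra ndvd => h; rewrite dvdn_mulr.
    by case: (not_recurrence_divisible_residue pp Sb hb pb ndvdb rec).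
  have b1 : (b != 1 %[mod p ^ k])%N.
    by apply: contra ndvd; rewrite eqn_mod_dvd // => h; rewrite dvdn_mull.
  by case: (not_recurrence_unit_residue pp k0 Sb pb b1 rec).
- apply: (@mult_recurrence_powers _ _ (a + b)%N%:R).
  + by move=> r [n [_ ->]]; rewrite /= ltr0n addn_gt0 hb orbT.
  + by rewrite ltr0n addn_gt0 hb orbT.
  (* b is idempotent modulo a. *)
  have bpow k : (b ^ k.+1 = b %[mod a])%N.
    elim: k => [//|k IH]; rewrite expnS -modnMmr IH modnMmr.
    apply/eqP; rewrite eqn_mod_dvd ?leq_pmulr //.
    by rewrite -[X in (_ - X)%N]muln1 -mulnBr.
  move=> k; have E : ((a + b) ^ k.+1 = b %[mod a])%N.
    by rewrite -modnXm modnDl modnXm bpow.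
  have ltb : (b < (a + b) ^ k.+1)%N.
    rewrite (@leq_trans (a + b)) // ?expnS ?leq_pmulr ?expn_gt0 ?addn_gt0 ?ha //.
    by rewrite -[X in (X < _)%N]add0n ltn_add2r.
  move/eqP: E; rewrite eqn_mod_dvd; last exact: ltnW.
  move=> /dvdnP[n En]; exists n; split.
    by rewrite lt0n; apply/eqP => n0; move: ltb; rewrite -subn_gt0 En n0.
  by rewrite -natrX -(subnK (ltnW ltb)) En mulnC.
Qed.
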